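(* Let $\mathsf P$ be a finite poset and let $(\mathcal X,\nu)$ be a $\mathsf P$-graded cell complex over a field $\mathbb K$ with boundary operator $\partial$. The algorithm ConnectionMatrix with input $(\mathcal X,\nu,\partial)$ halts. Moreover, if $(A_\infty,\Delta,\mu)$ is the returned data and $\pi=\pi^\mu$ is the $\mathsf P$-grading of $C(A_\infty)$ given by the projections $\pi_j^p\colon C_j(A_\infty)\to C_j(A_\infty\cap\mu^{-1}(p))$, then $(C(A_\infty),\Delta,\pi)$ is a Conley complex for $(C(\mathcal X),\pi^\nu)$.
   Context: Cell complex: a finite poset $(\mathcal X,\leq)$ with an order-preserving $\dim\colon\mathcal X\to\mathbb N$ and $\kappa\colon\mathcal X\times\mathcal X\to\mathbb K$ such that $\kappa(\xi,\xi')\neq0$ implies $\xi'\leq\xi$ and $\dim\xi=\dim\xi'+1$, and $\sum_{\xi'}\kappa(\xi,\xi')\kappa(\xi',\xi'')=0$. $C_n(\mathcal X)$ has basis the $n$-dimensional cells and $\partial\xi=\sum_{\xi'}\kappa(\xi,\xi')\xi'$. A $\mathsf P$-graded cell complex is a cell complex with an order-preserving map $\nu\colon(\mathcal X,\leq)\to\mathsf P$; write $\mathcal X^p=\nu^{-1}(p)$, itself a cell complex by restriction. $\pi^\nu$ denotes the projections $C_j(\mathcal X)\to C_j(\mathcal X^p)$ for the decomposition $C_j(\mathcal X)=\bigoplus_pC_j(\mathcal X^p)$. $\mathsf P$-graded chain complexes: a $\mathsf P$-graded vector space is a finite-dimensional $\mathbb K$-vector space $V$ with idempotents $\pi^p$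 ($p\in\mathsf P$), $\sum_p\pi^p=\mathrm{id}$, $\pi^p\pi^q=0$ for $p\ne q$. A linear map $\phi$ is $\mathsf P$-filtered if $\phi^{pq}:=\pi^p\phi\pi^q\neq0$ implies $p\leq q$. A $\mathsf P$-graded chain complex is a chain complex of $\mathsf P$-graded vector spaces with $\mathsf P$-filtered boundary maps. Two such are $\mathsf P$-filtered chain equivalent if there are $\mathsf P$-filtered chain maps in both directions whose compositions are homotopic to the identities via $\mathsf P$-filtered chain homotopies. A Conley complex for $(C,\pi)$ is a $\mathsf P$-graded chain complex $(C',\pi)$ that is strict ($\partial_j'^{pp}=0$ for all $p,j$) and $\mathsf P$-filtered chain equivalent to $(C,\pi)$. Partial matchings: a partial matching of $\mathcal X$ is a partition $\mathcal X=A\sqcup K\sqcup Q$ with a bijection $w\colon Q\to K$ such that $\kappa(w(\xi),\xi)\neq0$; it is acyclic if the transitive closure of the relation $\xi'\ll\xi\iff\kappa(w(\xi),\xi')\neq0$ on $Q$ generates a partial order. Define $V(\xi)=\kappa(w(\xi),\xi)^{-1}w(\xi)$ for $\xi\in Q$ and $V=0$ on $A\sqcup K$, and $\gamma=\sum_{i\geq0}V(\mathrm{id}-\partial V)^i$. With $\iota_A,\pi_A$ the canonical inclusion and projection between $C(A)$ and $C(\mathcal X)$, set $\psi=\pi_A(\mathrm{id}-\partial\gamma)$, $\phi=(\mathrm{id}-\gamma\partial)\iota_A$, $\partial^A=\psi\partial\phi$. Subroutine Matching($\mathcal X$): start with $\mathcal X'=\mathcal X$ and $A=K=Q=\varnothing$.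 While $\mathcal X'\neq\varnothing$: if $\mathcal X'$ admits a coreduction pair $(\xi,\xi')$, i.e. $\xi,\xi'\in\mathcal X'$ with $\kappa(\xi,\xi')\neq0$ and $\kappa(\xi,\eta)=0$ for all $\eta\in\mathcal X'\setminus\{\xi'\}$, remove both from $\mathcal X'$, put $\xi$ in $K$, $\xi'$ in $Q$ and set $w(\xi')=\xi$; otherwise choose a free cell $\xi\in\mathcal X'$ (i.e. $\kappa(\xi,\xi')=0$ for all $\xi'\in\mathcal X'$), remove it from $\mathcal X'$ and put it in $A$. Return $(A,w\colon Q\to K)$. Algorithm ConnectionMatrix($\mathcal X_{in},\nu_{in},\partial_{in}$): set $A:=\mathcal X_{in}$, $\Delta:=\partial_{in}$, $\mu:=\nu_{in}$. Do: set $\mathcal X:=A$, $\partial:=\Delta$, $\nu:=\mu$ (with $\kappa$ the matrix coefficients of $\partial$); for each $p\in\mathsf P$ let $(A^p,w^p\colon Q^p\to K^p)=$ Matching$(\mathcal X^p)$; let $(A,w)=(\bigsqcup_pA^p,\bigsqcup_pw^p)$; compute $\Delta:=\partial^A$ on $C(A)$ (via the map $\gamma$ of the matching $(A,w)$); set $\mu:=\nu|_A$. Repeat while $|A|<|\mathcal X|$. Return $(A,\Delta,\mu)$. *)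

(* Defs.v *)
From HB Require Import structures.
From mathcomp Require Import all_boot all_order all_algebra.

Set Implicit Arguments.
Unset Strict Implicit.
Unset Printing Implicit Defensive.

Import Order.TTheory GRing.Theory.
Local Open Scope ring_scope.

Notation chains K T := {ffun T -> K^o} (only parsing).

Definition basis_chain (K : fieldType) (T : finType) (x : T) : chains K T :=
  [ffun y => (y == x)%:R].

Definition linear_ext (K : fieldType) (T S : finType) (f : T -> chains K S) :
    'Hom(chains K T, chains K S) :=
  linfun (fun c : chains K T => \sum_x (c x : K) *: f x).

Definition coef (K : fieldType) (T : finType) (D : 'End(chains K T))
    (x y : T) : K := (D (basis_chain K x) : chains K T) y.

Definition incl (K : fieldType) (T : finType) (a : pred T) :
    'Hom(chains K {x : T | a x}, chains K T) :=
  linear_ext (fun x : {x : T | a x} => basis_chain K (val x)).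

Definition restr (K : fieldType) (T : finType) (a : pred T) :
    'Hom(chains K T, chains K {x : T | a x}) :=
  linear_ext (fun x : T =>
    if insub x is Some y then basis_chain K (y : {x : T | a x}) else 0).

Record cell_complex (K : fieldType) (d : Order.disp_t) (X : finPOrderType d) :=
  CellComplex {
    cell_dim : X -> nat;
    kappa : X -> X -> K;
    cell_dim_homo : forall x y : X, (x <= y)%O -> (cell_dim x <= cell_dim y)%N;
    kappa_face : forall x y : X, kappa x y != 0 ->
      (y <= x)%O /\ cell_dim x = (cell_dim y).+1;
    kappa_sq : forall x z : X, \sum_(y : X) kappa x y * kappa y z = 0
  }.

Definition cell_boundary (K : fieldType) (d : Order.disp_t)
    (X : finPOrderType d) (cx : cell_complex K X) : 'End(chains K X) :=
  linear_ext (fun x : X => \sum_(y : X) kappa cx x y *: basis_chain K y).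

(* Bare data; the axioms are in [pgraded_complex].  The family [bd] is indexed
   by source and target degrees, which avoids transporting along equalities such
   as [i + 1 - 1 = i]; only the components from [j + 1] to [j] may be nonzero. *)
Record pgraded_data (K : fieldType) (P : Type) := PGradedData {
  space : int -> vectType K;
  bd : forall i j : int, 'Hom(space i, space j);
  proj : forall i : int, P -> 'End(space i)
}.

Definition pgrading (K : fieldType) (P : finType) (V : vectType K)
    (pi : P -> 'End(V)) : Prop :=
  [/\ forall p, (pi p \o pi p)%VF = pi p,
      forall p q, p != q -> (pi p \o pi q)%VF = 0
    & \sum_p pi p = \1%VF].

Definition pfiltered (K : fieldType) (d : Order.disp_t) (P : finPOrderType d)
    (V W : vectType K) (piV : P -> 'End(V)) (piW : P -> 'End(W))
    (phi : 'Hom(V, W)) : Prop :=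
  forall p q : P, (piW p \o phi \o piV q)%VF != 0 -> (p <= q)%O.

Definition pgraded_complex (K : fieldType) (d : Order.disp_t)
    (P : finPOrderType d) (C : pgraded_data K P) : Prop :=
  [/\ forall i, pgrading (@proj K P C i),
      forall i j, bd C i j != 0 -> i = j + 1,
      forall i j k, (bd C j k \o bd C i j)%VF = 0
    & forall i j, pfiltered (@proj K P C i) (@proj K P C j) (bd C i j)].

Definition strict (K : fieldType) (P : Type) (C : pgraded_data K P) : Prop :=
  forall i j p, (proj C j p \o bd C i j \o proj C i p)%VF = 0.

Definition pfiltered_chain_map (K : fieldType) (d : Order.disp_t)
    (P : finPOrderType d) (C D : pgraded_data K P)
    (f : forall i, 'Hom(space C i, space D i)) : Prop :=
  (forall i j, (f j \o bd C i j)%VF = (bd D i j \o f i)%VF) /\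
  (forall i, pfiltered (@proj K P C i) (@proj K P D i) (f i)).

Definition pfiltered_homotopic_id (K : fieldType) (d : Order.disp_t)
    (P : finPOrderType d) (C : pgraded_data K P)
    (f : forall i, 'End(space C i)) : Prop :=
  exists h : forall i j, 'Hom(space C i, space C j),
    [/\ forall i j, h i j != 0 -> j = i + 1,
        forall i j, pfiltered (@proj K P C i) (@proj K P C j) (h i j)
      & forall i, f i - \1%VF =
          (bd C (i + 1) i \o h i (i + 1))%VF
          + (h (i - 1) i \o bd C i (i - 1))%VF].

Definition pfiltered_equivalent (K : fieldType) (d : Order.disp_t)
    (P : finPOrderType d) (C D : pgraded_data K P) : Prop :=
  [/\ pgraded_complex C, pgraded_complex D
    & exists f : forall i, 'Hom(space C i, space D i),
      exists g : forall i, 'Hom(space D i, space C i),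
        [/\ pfiltered_chain_map f, pfiltered_chain_map g,
            pfiltered_homotopic_id (fun i => (g i \o f i)%VF)
          & pfiltered_homotopic_id (fun i => (f i \o g i)%VF)]].

Definition conley_complex (K : fieldType) (d : Order.disp_t)
    (P : finPOrderType d) (C' C : pgraded_data K P) : Prop :=
  [/\ pgraded_complex C', strict C' & pfiltered_equivalent C' C].

(* A triple (A, Delta, mu) of the algorithm; the dimensions are kept along in
   order to define C_j(A). *)
Record based_data (K : fieldType) (P : Type) := BasedData {
  cells : finType;
  bdim : cells -> nat;
  bdelta : 'End(chains K cells);
  bgrade : cells -> P
}.

Definition bkappa (K : fieldType) (P : Type) (D : based_data K P) :
  cells D -> cells D -> K := coef (bdelta D).

(* All the homogeneous components of [bdelta D] are recorded, so that
   [pgraded_complex (chain_data D)] entails that it has degree -1. *)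
Definition chain_data (K : fieldType) (P : finType) (D : based_data K P) :
    pgraded_data K P :=
  let deg (i : int) : pred (cells D) := fun x => (bdim x)%:Z == i in
  @PGradedData K P
    (fun i => chains K {x : cells D | deg i x})
    (fun i j => (restr K (deg j) \o bdelta D \o incl K (deg i))%VF)
    (fun i p => linear_ext (fun x : {x : cells D | deg i x} =>
       if bgrade (val x) == p then basis_chain K x else 0)).

Definition cell_data (K : fieldType) (d : Order.disp_t) (X : finPOrderType d)
    (P : Type) (cx : cell_complex K X) (nu : X -> P) : based_data K P :=
  @BasedData K P X (cell_dim cx) (cell_boundary cx) nu.

(* The values of [mw] outside of [mQ] are irrelevant. *)
Record matching (T : finType) := Matching {
  mA : {set T};
  mK : {set T};
  mQ : {set T};
  mw : T -> T
}.

Definition coreduction_pair (K : fieldType) (T : finType) (k : T -> T -> K)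
    (R : {set T}) (x y : T) : Prop :=
  [/\ x \in R, y \in R, k x y != 0
    & forall z, z \in R :\ y -> k x z = 0].

Definition free_cell (K : fieldType) (T : finType) (k : T -> T -> K)
    (R : {set T}) (x : T) : Prop :=
  x \in R /\ forall y, y \in R -> k x y = 0.

(* States of the loop: the set X' of cells still to be treated, and the matching
   built so far. *)
Definition mstate (T : finType) : Type := ({set T} * matching T)%type.

Definition matching_start (T : finType) (S : {set T}) : mstate T :=
  (S, @Matching T set0 set0 set0 id).

Inductive matching_step (K : fieldType) (T : finType) (k : T -> T -> K) :
    mstate T -> mstate T -> Prop :=
  | MatchPair (R : {set T}) (m : matching T) (x y : T) :
      coreduction_pair k R x y ->
      matching_step k (R, m)
        (R :\: [set x; y],
         @Matching T (mA m) (x |: mK m) (y |: mQ m) [eta mw m with y |-> x])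
  | MatchFree (R : {set T}) (m : matching T) (x : T) :
      (forall y z, ~ coreduction_pair k R y z) ->
      free_cell k R x ->
      matching_step k (R, m)
        (R :\ x, @Matching T (x |: mA m) (mK m) (mQ m) (mw m)).

Inductive matching_leads_to (K : fieldType) (T : finType) (k : T -> T -> K) :
    mstate T -> matching T -> Prop :=
  | MatchDone (m : matching T) : matching_leads_to k (set0, m) m
  | MatchMore (s s' : mstate T) (m : matching T) :
      matching_step k s s' -> matching_leads_to k s' m ->
      matching_leads_to k s m.

(* All executions from [s] are finite, and none of them gets stuck (for lack of
   a coreduction pair and of a free cell) while X' is nonempty. *)
Inductive matching_halts (K : fieldType) (T : finType) (k : T -> T -> K) :
    mstate T -> Prop :=
  MatchHalts (s : mstate T) :
    (s.1 = set0 \/ exists s', matching_step k s s') ->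
    (forall s', matching_step k s s' -> matching_halts k s') ->
    matching_halts k s.

Definition matching_V (K : fieldType) (T : finType) (k : T -> T -> K)
    (m : matching T) : 'End(chains K T) :=
  linear_ext (fun x =>
    if x \in mQ m then (k (mw m x) x)^-1 *: basis_chain K (mw m x) else 0).

(* [g] is the sum over all [i >= 0] of V (id - D V)^i; the terms are required
   to vanish from some rank on. *)
Definition is_gamma (K : fieldType) (U : vectType K) (D V g : 'End(U)) : Prop :=
  let term (i : nat) : 'End(U) :=
    (V \o iter i (comp_lfun (\1 - (D \o V))) \1)%VF in
  exists N : nat,
    (forall i, (N <= i)%N -> term i = 0) /\ g = \sum_(i < N) term i.

Definition reduced_boundary (K : fieldType) (T : finType) (A : {set T})
    (D g : 'End(chains K T)) : 'End(chains K {x : T | x \in A}) :=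
  let psi := (restr K (mem A) \o (\1 - (D \o g)))%VF in
  let phi := ((\1 - (g \o D)) \o incl K (mem A))%VF in
  (psi \o D \o phi)%VF.

Definition fiber (K : fieldType) (P : finType) (D : based_data K P) (p : P) :
    {set cells D} :=
  [set x | bgrade x == p].

(* When [m p] is a matching of the fiber of [nu] over [p], this is the disjoint
   union of these matchings. *)
Definition union_matching (T P : finType) (nu : T -> P) (m : P -> matching T) :
    matching T :=
  @Matching T (\bigcup_p mA (m p)) (\bigcup_p mK (m p)) (\bigcup_p mQ (m p))
    (fun x => mw (m (nu x)) x).

Definition reduced_data (K : fieldType) (P : Type) (D : based_data K P)
    (A : {set cells D}) (g : 'End(chains K (cells D))) : based_data K P :=
  @BasedData K P {x : cells D | x \in A} (fun x => bdim (val x))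
    (reduced_boundary A (bdelta D) g) (fun x => bgrade (val x)).

Inductive cm_body (K : fieldType) (P : finType) (D : based_data K P) :
    based_data K P -> Prop :=
  CMBody (m : P -> matching (cells D)) (g : 'End(chains K (cells D))) :
    (forall p,
       matching_leads_to (@bkappa K P D) (matching_start (fiber D p)) (m p)) ->
    let u := union_matching (@bgrade K P D) m in
    is_gamma (bdelta D) (matching_V (@bkappa K P D) u) g ->
    cm_body D (reduced_data (mA u) g).

Inductive cm_returns (K : fieldType) (P : finType) :
    based_data K P -> based_data K P -> Prop :=
  | CMReturn (D D' : based_data K P) :
      cm_body D D' -> ~ (#|cells D'| < #|cells D|)%N -> cm_returns D D'
  | CMRepeat (D D' E : based_data K P) :
      cm_body D D' -> (#|cells D'| < #|cells D|)%N -> cm_returns D' E ->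
      cm_returns D E.

(* All executions are finite and none gets stuck: all the calls of Matching
   halt, the body of the loop can be carried through, in particular gamma is
   defined for every outcome of the calls of Matching, and the loop is repeated
   finitely many times. *)
Inductive cm_halts (K : fieldType) (P : finType) : based_data K P -> Prop :=
  CMHalts (D : based_data K P) :
    (forall p,
       matching_halts (@bkappa K P D) (matching_start (fiber D p))) ->
    (forall m : P -> matching (cells D),
       (forall p, matching_leads_to (@bkappa K P D)
                    (matching_start (fiber D p)) (m p)) ->
       exists g, is_gamma (bdelta D)
         (matching_V (@bkappa K P D) (union_matching (@bgrade K P D) m)) g) ->
    (forall D', cm_body D D' -> (#|cells D'| < #|cells D|)%N -> cm_halts D') ->
    cm_halts D.

(* Main.v *)
Require Import Defs.
From mathcomp Require Import all_boot all_order all_algebra.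
From HB Require Import structures.
From mathcomp Require Import zify.

(** Write D for the boundary operator and V for the operator of a matching.  The
    operator gamma is V times the geometric series in id - D V, so, as soon as
    the terms vanish eventually, telescoping gives V D gamma = V = gamma D V, and
    hence gamma D gamma = gamma; moreover gamma gamma = 0 because V V = 0.
    Thus gamma is a splitting homotopy, and
    id - D gamma - gamma D is an idempotent chain map.  The space C(A) is its
    image: V D gamma = V says that id - D gamma takes its values in chains
    without component on Q, and gamma D V = V says that id - gamma D kills K, so
    that only A is left between the two factors of
    id - D gamma - gamma D = (id - gamma D)(id - D gamma)
    ([comp_through_A]).  Therefore phi and psi make the reduced complex a strong
    deformation retract of C(X), with psi phi = id and homotopy -gamma
    ([retract_psi_phi], [retract_phi_psi]).

    The terms of gamma do vanish because the matching is acyclic: a coreduction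
    pair (w(x), x) is removed at a time when x is the only remaining face of
    w(x) in its fibre, so all other such faces were removed before, and a face in
    another fibre has a smaller grade.  Ordering Q by grade first and by time of
    removal second gives a rank that id - D V decreases modulo cells outside of
    Q ([matching_rank], [acyclic_union_matching], [gamma_exists]).

    All the maps have a fixed degree and respect the grading, since w stays in
    the fibres.  So each pass through the loop yields a filtered deformation
    retract, and these compose ([filtered_retract_trans]).  The number of cells
    drops strictly at each repetition, whence termination.  In the last pass no
    cell is paired, so gamma = 0 and the boundary operator is unchanged; a
    nonzero coefficient inside a fibre would have led to a coreduction
    pair at some stage ([unmatched_coef0]), so the returned complex is strict.

    Since dimension and grade are read off the cells, all of this is done
    with operators on the total chain spaces, with conditions on their
    coefficients ([filtered_homog]); only at the end are the operators cut into
    their homogeneous components ([piece]). *)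

Set Implicit Arguments.
Unset Strict Implicit.
Unset Printing Implicit Defensive.

Import Order.TTheory GRing.Theory.
Local Open Scope ring_scope.
Local Open Scope lfun_scope.

(** * Linear maps between spaces of chains *)

Section LinearExtension.
Variables (K : fieldType) (T S : finType) (f : T -> chains K S).

Definition linear_ext_fun (c : chains K T) : chains K S :=
  \sum_x (c x : K) *: f x.

Fact linear_ext_fun_is_linear : linear linear_ext_fun.
Proof.
move=> a c d; rewrite /linear_ext_fun scaler_sumr -big_split /=.
by apply: eq_bigr => x _; rewrite !ffunE scalerDl scalerA.
Qed.

HB.instance Definition _ :=
  GRing.isLinear.Build K (chains K T) (chains K S) _ linear_ext_fun
    linear_ext_fun_is_linear.

Lemma linear_extE (c : chains K T) :
  linear_ext f c = \sum_x (c x : K) *: f x.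
Proof. exact: (lfunE linear_ext_fun c). Qed.

Lemma linear_ext_basis x : linear_ext f (basis_chain K x) = f x.
Proof.
rewrite linear_extE (bigD1 x) //= big1 ?addr0 => [|y /negPf y'x].
  by rewrite ffunE eqxx scale1r.
by rewrite ffunE y'x scale0r.
Qed.

End LinearExtension.

Section Chains.
Variable K : fieldType.
Implicit Types T S : finType.

Lemma chain_expand T (c : chains K T) :
  c = \sum_x (c x : K) *: basis_chain K x.
Proof.
apply/ffunP => y; rewrite sum_ffunE (bigD1 y) //= big1 => [|x /negPf x'y].
  by rewrite !ffunE eqxx addr0 [RHS]mulr1.
by rewrite !ffunE eq_sym x'y scaler0.
Qed.

Lemma lfun_expand T (W : vectType K) (f : 'Hom(chains K T, W)) c :
  f c = \sum_x (c x : K) *: f (basis_chain K x).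
Proof.
rewrite {1}[c]chain_expand linear_sum; apply: eq_bigr => x _; exact: linearZ.
Qed.

Lemma lfun_basisP T (W : vectType K) (f g : 'Hom(chains K T, W)) :
  (forall x, f (basis_chain K x) = g (basis_chain K x)) -> f = g.
Proof.
move=> fg; apply/lfunP => c; rewrite 2!lfun_expand.
by apply: eq_bigr => x _; rewrite fg.
Qed.

(** Cancellation in a matrix product can lose coefficients but not create
    them. *)
Lemma comp_coef_neq0 T S (W : finType) (f : 'Hom(chains K T, chains K S))
    (g : 'Hom(chains K S, chains K W)) x z :
  (g \o f)%VF (basis_chain K x) z != 0 ->
  exists y, f (basis_chain K x) y != 0 /\ g (basis_chain K y) z != 0.
Proof.
rewrite comp_lfunE lfun_expand sum_ffunE => nz.
have /existsP[y /andP[]] : [exists y, (f (basis_chain K x) y != 0) &&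
    (g (basis_chain K y) z != 0)].
  apply: contraR nz; rewrite negb_exists => /forallP zero; apply/eqP.
  apply: big1 => y _; rewrite ffunE.
  move: (zero y); rewrite negb_and !negbK => /orP[/eqP->|/eqP->].
    by rewrite scale0r.
  by rewrite scaler0.
by exists y.
Qed.

Lemma lfun_neq0 T S (f : 'Hom(chains K T, chains K S)) :
  f != 0 -> exists x y, f (basis_chain K x) y != 0.
Proof.
move=> nz; have /existsP[x /existsP[y]] :
    [exists x, [exists y, f (basis_chain K x) y != 0]].
  apply: contraR nz; rewrite negb_exists => /forallP zero; apply/eqP.
  apply: lfun_basisP => x; apply/ffunP => y; rewrite lfunE ffunE.
  by move: (zero x); rewrite negb_exists => /forallP/(_ y); rewrite negbK => /eqP.
by exists x, y.
Qed.

Variables (T : finType) (a : pred T).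

Lemma incl_basis (x : {x | a x}) :
  incl K a (basis_chain K x) = basis_chain K (val x).
Proof. exact: linear_ext_basis. Qed.

Lemma restrE (c : chains K T) y : restr K a c y = c (val y).
Proof.
rewrite linear_extE sum_ffunE (bigD1 (val y)) //= big1 ?addr0 => [|x x'y].
  by rewrite valK !ffunE eqxx [LHS]mulr1.
rewrite ffunE; case: insubP => [z _ zx|_]; last by rewrite ffunE scaler0.
rewrite ffunE; case: eqP => [yz|]; last by rewrite scaler0.
by rewrite -zx yz eqxx in x'y.
Qed.

Lemma restr_incl : (restr K a \o incl K a)%VF = \1%VF.
Proof.
apply: lfun_basisP => x; rewrite comp_lfunE incl_basis id_lfunE.
by apply/ffunP => y; rewrite restrE !ffunE.
Qed.

Lemma incl_restrE (c : chains K T) y :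
  incl K a (restr K a c) y = if a y then c y else 0.
Proof.
rewrite linear_extE sum_ffunE; case: ifPn => ay.
  rewrite (bigD1 (Sub y ay)) //= big1 ?addr0 => [|x x'y].
    by rewrite ffunE restrE ffunE eqxx [LHS]mulr1.
  rewrite !ffunE; case: eqP => [yx|]; last by rewrite scaler0.
  by case/eqP: x'y; apply: val_inj.
apply: big1 => x _; rewrite !ffunE; case: eqP => [yx|]; last by rewrite scaler0.
by rewrite yx (valP x) in ay.
Qed.

Lemma incl_restr_id (c : chains K T) :
  (forall x, c x != 0 -> a x) -> incl K a (restr K a c) = c.
Proof.
move=> supp; apply/ffunP => y; rewrite incl_restrE.
by case: ifPn => // /(contraNeq (supp y)) ->.
Qed.

End Chains.

(** * The geometric series gamma as a splitting homotopy *)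

Section SplittingHomotopy.
Variables (K : fieldType) (U : vectType K) (D V : 'End(U)).

Definition gamma_ratio : 'End(U) := \1 - (D \o V).
Definition gamma_power i : 'End(U) := iter i (comp_lfun gamma_ratio) \1.
Local Notation B := gamma_ratio.
Local Notation pow := gamma_power.

Lemma comp_DV : (D \o V)%VF = \1 - B.
Proof. by rewrite /B opprB addrCA subrr addr0. Qed.

Lemma gamma_powerSr i : pow i.+1 = (pow i \o B)%VF.
Proof.
elim: i => [|i IH]; first by rewrite /pow /= comp_lfun1l comp_lfun1r.
have powS n : pow n.+1 = (B \o pow n)%VF by [].
by rewrite powS {1}IH comp_lfunA.
Qed.

Lemma gamma_sumE (N : nat) :
  \sum_(i < N) (V \o pow i)%VF = (V \o \sum_(i < N) pow i)%VF.
Proof.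
elim: N => [|N IH]; first by rewrite !big_ord0 comp_lfun0r.
by rewrite !big_ord_recr /= comp_lfunDr IH.
Qed.

(** The ratio id - D V is the identity on the kernel of V. *)
Lemma gamma_power_fix i c : V c = 0 -> pow i c = c.
Proof.
move=> Vc; have Bc : B c = c.
  by rewrite add_lfunE opp_lfunE comp_lfunE id_lfunE Vc linear0 subr0.
by elim: i => [|i IH]; [rewrite id_lfunE | rewrite gamma_powerSr comp_lfunE Bc].
Qed.

Variable g : 'End(U).
Hypothesis gP : is_gamma D V g.

Lemma gamma_factor : exists S : 'End(U), g = (V \o S)%VF.
Proof. by case: gP => N [_ ->]; rewrite gamma_sumE; eexists. Qed.

(** With B = id - D V, this is (id - B)(id + B + ... + B^(N-1)) = id - B^N,
    multiplied by V on the left, where V B^N = 0. *)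
Lemma comp_VDgamma : (V \o D \o g)%VF = V.
Proof.
case: gP => N [vanish ->]; rewrite gamma_sumE -comp_lfunA (comp_lfunA D) comp_DV.
have tele: ((\1 - B) \o \sum_(i < N) pow i)%VF = \1 - pow N.
  elim: N {vanish} => [|N IH]; first by rewrite big_ord0 comp_lfun0r subrr.
  rewrite big_ord_recr /= comp_lfunDr IH comp_lfunDl comp_lfunNl comp_lfun1l.
  by rewrite addrA subrK.
by rewrite tele comp_lfunDr comp_lfunNr comp_lfun1r [X in _ - X]vanish ?subr0.
Qed.

(** The same telescoping, with the factor id - B = D V on the right. *)
Lemma comp_gammaDV : (g \o D \o V)%VF = V.
Proof.
case: gP => N [vanish ->]; rewrite -comp_lfunA [X in (_ \o X)%VF]comp_DV.
have tele: ((\sum_(i < N) (V \o pow i)) \o (\1 - B))%VF = V - (V \o pow N)%VF.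
  elim: N {vanish} => [|N IH].
    by rewrite big_ord0 comp_lfun0l /pow /= comp_lfun1r subrr.
  rewrite big_ord_recr /= comp_lfunDl IH comp_lfunDr comp_lfunNr comp_lfun1r.
  by rewrite -comp_lfunA -gamma_powerSr addrA subrK.
by rewrite tele [X in _ - X]vanish ?subr0.
Qed.

Lemma gamma_comp0 (W : vectType K) (h : 'Hom(W, U)) :
  (V \o h)%VF = 0 -> (g \o h)%VF = 0.
Proof.
move=> Vh; case: gP => N [_ ->]; rewrite gamma_sumE.
have powh i : (pow i \o h)%VF = h.
  apply/lfunP => c; rewrite comp_lfunE gamma_power_fix //.
  by rewrite -comp_lfunE Vh lfunE.
elim: N => [|N IH]; first by rewrite big_ord0 comp_lfun0r comp_lfun0l.
by rewrite big_ord_recr /= comp_lfunDr comp_lfunDl IH -comp_lfunA powh Vh addr0.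
Qed.

(** Perturbation of a splitting U = W + ker rho into a splitting of complexes.
    For a matching, the hypothesis [mid] comes from [comp_through_A]. *)
Section Retract.
Variables (W : vectType K) (iota : 'Hom(W, U)) (rho : 'Hom(U, W)).
Hypothesis (DD : (D \o D)%VF = 0) (VV : (V \o V)%VF = 0).
Hypothesis (rho_iota : (rho \o iota)%VF = \1%VF).
Hypothesis (Viota : (V \o iota)%VF = 0) (rhoV : (rho \o V)%VF = 0).
Hypothesis mid : ((\1 - (g \o D)) \o (iota \o rho) \o (\1 - (D \o g))
                  = (\1 - (g \o D)) \o (\1 - (D \o g)))%VF.

Let phi : 'Hom(W, U) := ((\1 - (g \o D)) \o iota)%VF.
Let psi : 'Hom(U, W) := (rho \o (\1 - (D \o g)))%VF.
Let DW : 'End(W) := (psi \o D \o phi)%VF.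

Let gg : (g \o g)%VF = 0.
Proof.
have [S gE] := gamma_factor.
by rewrite {2}gE comp_lfunA (gamma_comp0 VV) comp_lfun0l.
Qed.

(** By [mid] the composite is (id - gamma D)(id - D gamma), and the product
    gamma D D gamma is zero. *)
Lemma retract_phi_psi : (phi \o psi - \1 = (D \o - g) + (- g \o D))%VF.
Proof.
rewrite /phi /psi !comp_lfunA -(comp_lfunA _ iota) mid.
rewrite !(comp_lfunDl, comp_lfunDr, comp_lfunNl, comp_lfunNr) ?comp_lfun1l ?comp_lfun1r.
have -> : (g \o D \o (D \o g) = 0)%VF.
  by rewrite -comp_lfunA (comp_lfunA D) DD comp_lfun0l comp_lfun0r.
by rewrite oppr0 oppr0 addr0 addrC !addrA addNr add0r addrC.
Qed.

(** Every correction term contains rho gamma, gamma gamma or gamma iota. *)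
Lemma retract_psi_phi : (psi \o phi = \1)%VF.
Proof.
have giota : (g \o iota)%VF = 0 by apply: gamma_comp0.
have rhog : (rho \o g)%VF = 0.
  by have [S ->] := gamma_factor; rewrite comp_lfunA rhoV comp_lfun0l.
rewrite /phi /psi.
rewrite !(comp_lfunDl, comp_lfunDr, comp_lfunNl, comp_lfunNr, comp_lfun1l, comp_lfun1r).
rewrite rho_iota !comp_lfunA rhog !comp_lfun0l.
rewrite -!comp_lfunA giota (comp_lfunA g g) gg !(comp_lfun0r, comp_lfun0l).
by rewrite !oppr0 !addr0.
Qed.

Let phi_psiE : (phi \o psi = \1 - (D \o g) - (g \o D))%VF.
Proof.
apply: (@addIr _ (- \1%VF)); rewrite retract_phi_psi comp_lfunNr comp_lfunNl.
by rewrite [RHS]addrC !addrA addNr add0r.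
Qed.

Let phi_psiD : (phi \o psi \o D = D \o (phi \o psi))%VF.
Proof.
rewrite phi_psiE !(comp_lfunDl, comp_lfunDr, comp_lfunNl, comp_lfunNr).
rewrite comp_lfun1l comp_lfun1r !comp_lfunA DD -(comp_lfunA g) DD.
by rewrite comp_lfun0l comp_lfun0r oppr0 !addr0.
Qed.

(** Since phi psi is homotopic to the identity, it commutes with D, so that
    phi psi D phi = D phi psi phi = D phi. *)
Lemma retract_phi_chain : (phi \o DW = D \o phi)%VF.
Proof.
rewrite /DW (comp_lfunA phi (psi \o D)) (comp_lfunA phi psi D) phi_psiD.
rewrite -(comp_lfunA D) -(comp_lfunA phi psi phi) retract_psi_phi.
by rewrite comp_lfun1r.
Qed.

Lemma retract_psi_chain : (psi \o D = DW \o psi)%VF.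
Proof.
rewrite /DW -(comp_lfunA _ phi psi) -(comp_lfunA psi D) -phi_psiD.
rewrite (comp_lfunA psi _ D) (comp_lfunA psi phi psi) retract_psi_phi.
by rewrite comp_lfun1l.
Qed.

Lemma retract_DD : (DW \o DW = 0)%VF.
Proof.
rewrite {2}/DW (comp_lfunA DW (psi \o D)) (comp_lfunA DW psi D).
rewrite -retract_psi_chain -(comp_lfunA psi D D) DD.
by rewrite comp_lfun0r comp_lfun0l.
Qed.

End Retract.

End SplittingHomotopy.

(** * Filtered maps of a given degree, and retracts *)

Section FilteredMaps.
Variables (K : fieldType) (dP : Order.disp_t) (P : finPOrderType dP).
Implicit Types D E F : based_data K P.

(** Degree and filtration in one condition on matrix coefficients, which makes
    sense on the total chain spaces, where no index has to be transported. *)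
Definition filtered_homog D E (n : int)
    (f : 'Hom(chains K (cells D), chains K (cells E))) :=
  forall x y, f (basis_chain K x) y != 0 ->
    (bdim y)%:Z = (bdim x)%:Z + n /\ (bgrade y <= bgrade x)%O.

Lemma filtered_homog_comp D E F m n (f : 'Hom(chains K (cells D), chains K (cells E)))
    (g : 'Hom(chains K (cells E), chains K (cells F))) k :
  filtered_homog m f -> filtered_homog n g -> k = m + n -> filtered_homog k (g \o f).
Proof.
move=> ff fg -> x z /comp_coef_neq0[y [/ff[dxy gxy] /fg[dyz gyz]]].
by split; [rewrite dyz dxy addrA | apply: le_trans gxy].
Qed.

Lemma filtered_homog_add D E n (f g : 'Hom(chains K (cells D), chains K (cells E))) :
  filtered_homog n f -> filtered_homog n g -> filtered_homog n (f + g).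
Proof.
move=> ff fg x y; rewrite lfunE /= ffunE.
have [fx0|/ff] := eqVneq (f (basis_chain K x) y) 0; last by [].
by rewrite fx0 add0r => /fg.
Qed.

Lemma filtered_homog_opp D E n (f : 'Hom(chains K (cells D), chains K (cells E))) :
  filtered_homog n f -> filtered_homog n (- f).
Proof. by move=> ff x y; rewrite lfunE /= ffunE oppr_eq0 => /ff. Qed.

Lemma filtered_homog0 D E n :
  filtered_homog n (0 : 'Hom(chains K (cells D), chains K (cells E))).
Proof. by move=> x y; rewrite lfunE /= ffunE eqxx. Qed.

Lemma filtered_homog_id D : filtered_homog 0 (\1 : 'End(chains K (cells D))).
Proof.
move=> x y; rewrite id_lfunE ffunE.
by case: (y =P x) => [-> _|_]; [rewrite addr0 | rewrite eqxx].
Qed.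

(** The loop invariant.  The order on the cells is forgotten: the algorithm
    only sees dimensions and grades. *)
Definition based_complex D :=
  (bdelta D \o bdelta D)%VF = 0 /\ filtered_homog (-1) (bdelta D).

(** A filtered deformation retraction of the complex of D onto that of E.  It is
    a special case of filtered chain equivalence, with zero homotopy on the side
    of E, and this makes composition simple. *)
Definition filtered_retract D E :=
  exists (f : 'Hom(chains K (cells E), chains K (cells D)))
         (g : 'Hom(chains K (cells D), chains K (cells E)))
         (h : 'End(chains K (cells D))),
  [/\ [/\ filtered_homog 0 f, filtered_homog 0 g & filtered_homog 1 h],
      (f \o bdelta E = bdelta D \o f)%VF, (g \o bdelta D = bdelta E \o g)%VF,
      (g \o f = \1)%VF
    & (f \o g - \1 = (bdelta D \o h) + (h \o bdelta D))%VF].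

(** The homotopy of the composite is h + f h' g, because
    f f' g' g - id = f (f' g' - id) g + (f g - id). *)
Lemma filtered_retract_trans D E F :
  filtered_retract D E -> filtered_retract E F -> filtered_retract D F.
Proof.
move=> [f [g [h [[ff fg fh] cf cg gf fgE]]]].
move=> [f' [g' [h' [[ff' fg' fh'] cf' cg' gf' fgE']]]].
exists (f \o f')%VF, (g' \o g)%VF, (h + (f \o h' \o g))%VF; split.
- split; [exact: filtered_homog_comp ff' ff _ | exact: filtered_homog_comp fg fg' _ |].
  apply: filtered_homog_add => //; apply: (@filtered_homog_comp _ _ _ 0 1) => //.
  exact: (@filtered_homog_comp _ _ _ 1 0).
- by rewrite -comp_lfunA cf' !comp_lfunA cf.
- by rewrite -comp_lfunA cg !comp_lfunA cg'.
- by rewrite comp_lfunA -(comp_lfunA g') gf comp_lfun1r.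
have -> : ((f \o f') \o (g' \o g) = (f \o ((f' \o g' - \1) + \1)) \o g)%VF.
  by rewrite subrK !comp_lfunA.
rewrite fgE' !(comp_lfunDl, comp_lfunDr) comp_lfun1r -addrA fgE.
rewrite [RHS]addrACA [RHS]addrC; congr (_ + _).
by rewrite !comp_lfunA cf -!comp_lfunA cg.
Qed.

End FilteredMaps.

(** * Homogeneous components *)

Section Pieces.
Variables (K : fieldType) (dP : Order.disp_t) (P : finPOrderType dP).
Implicit Types D E F : based_data K P.

Definition has_dim D (i : int) : pred (cells D) := fun x => (bdim x)%:Z == i.

Definition piece D E (i j : int) (f : 'Hom(chains K (cells D), chains K (cells E))) :
    'Hom(Defs.space (chain_data D) i, Defs.space (chain_data E) j) :=
  (restr K (@has_dim E j) \o f \o incl K (@has_dim D i))%VF.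

Lemma piece_coef D E i j (f : 'Hom(chains K (cells D), chains K (cells E))) x y :
  piece i j f (basis_chain K x) y = f (basis_chain K (val x)) (val y).
Proof. by rewrite !comp_lfunE restrE incl_basis. Qed.

Lemma piece_neq0 D E i j n (f : 'Hom(chains K (cells D), chains K (cells E))) :
  filtered_homog n f -> piece i j f != 0 -> j = i + n.
Proof.
move=> ff /lfun_neq0[x [y]]; rewrite piece_coef => /ff[]; case: x y => x /= /eqP <-.
by case=> y /= /eqP <-.
Qed.

Lemma piece_off D E i j n (f : 'Hom(chains K (cells D), chains K (cells E))) :
  filtered_homog n f -> j <> i + n -> piece i j f = 0.
Proof. by move=> ff ne; apply/eqP; apply/contraT => /(piece_neq0 ff). Qed.

(** Cutting into components is functorial as soon as one of the two factors is
    homogeneous: then only one intermediate degree j contributes.  This first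
    version has the condition on the inner factor, the next one on the outer
    factor. *)
Lemma piece_comp_degl D E F n i j k
    (f : 'Hom(chains K (cells D), chains K (cells E)))
    (g : 'Hom(chains K (cells E), chains K (cells F))) :
  filtered_homog n f -> j = i + n ->
  (piece j k g \o piece i j f)%VF = piece i k (g \o f)%VF.
Proof.
move=> ff jE; apply: lfun_basisP => x; rewrite !comp_lfunE incl_basis.
rewrite incl_restr_id // => y /ff[dy _]; rewrite /has_dim dy jE.
by case: x dy => x /= /eqP <-.
Qed.

Lemma piece_comp_degr D E F n i j k
    (f : 'Hom(chains K (cells D), chains K (cells E)))
    (g : 'Hom(chains K (cells E), chains K (cells F))) :
  filtered_homog n g -> k = j + n ->
  (piece j k g \o piece i j f)%VF = piece i k (g \o f)%VF.
Proof.
move=> fg kE; apply: lfun_basisP => x; rewrite !comp_lfunE incl_basis.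
apply/ffunP => z; rewrite !restrE.
rewrite (lfun_expand g) [in RHS](lfun_expand g) !sum_ffunE.
apply: eq_bigr => y _; rewrite incl_restrE; case: ifPn => // ny.
rewrite !ffunE scale0r; apply/esym.
have [->|/fg[dz _]] := eqVneq (g (basis_chain K y) (val z)) 0; first exact: scaler0.
case/eqP: ny; apply: (@addIr _ n); rewrite -dz -kE.
exact/eqP/(valP z).
Qed.

Lemma pieceD D E i j (f g : 'Hom(chains K (cells D), chains K (cells E))) :
  piece i j (f + g) = piece i j f + piece i j g.
Proof. by rewrite /piece comp_lfunDr comp_lfunDl. Qed.

Lemma pieceN D E i j (f : 'Hom(chains K (cells D), chains K (cells E))) :
  piece i j (- f) = - piece i j f.
Proof. by rewrite /piece comp_lfunNr comp_lfunNl. Qed.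

Lemma piece1 D i : piece i i (\1 : 'End(chains K (cells D))) = \1%VF.
Proof. by rewrite /piece comp_lfun1r; exact: restr_incl. Qed.

Lemma projE D i p c x :
  proj (chain_data D) i p c x = if bgrade (val x) == p then c x else 0.
Proof.
rewrite linear_extE sum_ffunE (bigD1 x) //= big1 ?addr0 => [|y /negPf yx].
  rewrite ffunE; case: eqP => _; last by rewrite ffunE scaler0.
  by rewrite ffunE eqxx [LHS]mulr1.
rewrite ffunE; case: eqP => _; last by rewrite ffunE scaler0.
by rewrite ffunE eq_sym yx scaler0.
Qed.

Lemma proj_basis D i p x : proj (chain_data D) i p (basis_chain K x) =
  if bgrade (val x) == p then basis_chain K x else 0.
Proof. exact: linear_ext_basis. Qed.

Lemma pgrading_chain_data D i : pgrading (@proj K P (chain_data D) i).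
Proof.
split=> [p|p q pq|].
- apply: lfun_basisP => x; rewrite comp_lfunE !proj_basis.
  by case: ifP => gx; rewrite ?linear0 // proj_basis gx.
- apply: lfun_basisP => x; rewrite comp_lfunE proj_basis lfunE.
  case: eqP => [xq|]; last by rewrite linear0.
  by rewrite proj_basis xq eq_sym (negPf pq).
- apply: lfun_basisP => x; rewrite sum_lfunE id_lfunE (bigD1 (bgrade (val x))) //=.
  rewrite proj_basis eqxx big1 ?addr0 // => p px.
  by rewrite proj_basis eq_sym (negPf px).
Qed.

Lemma block_neq0 D E i j p q (f : 'Hom(chains K (cells D), chains K (cells E))) :
  (proj (chain_data E) j p \o piece i j f \o proj (chain_data D) i q)%VF != 0 ->
  exists x y, [/\ f (basis_chain K x) y != 0, bgrade x = q & bgrade y = p].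
Proof.
move=> /lfun_neq0[x [y]]; rewrite !comp_lfunE proj_basis.
case: (bgrade (val x) =P q) => [gx|_]; last by rewrite !linear0 ffunE eqxx.
rewrite projE; case: (bgrade (val y) =P p) => [gy|_]; last by rewrite eqxx.
by rewrite restrE incl_basis; exists (val x), (val y).
Qed.

Lemma pfiltered_piece D E i j n (f : 'Hom(chains K (cells D), chains K (cells E))) :
  filtered_homog n f ->
  pfiltered (@proj K P (chain_data D) i) (@proj K P (chain_data E) j) (piece i j f).
Proof. by move=> ff p q /block_neq0[x [y [/ff[_ le] <- <-]]]. Qed.

Lemma pgraded_chain_data D : based_complex D -> pgraded_complex (chain_data D).
Proof.
move=> [DD fD]; split=> [i|i j|i j k|i j].
- exact: pgrading_chain_data.
- by move=> /(piece_neq0 fD) ->; rewrite subrK.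
- have -> : bd (chain_data D) i j = piece i j (bdelta D) by [].
  have -> : bd (chain_data D) j k = piece j k (bdelta D) by [].
  have [jE|/eqP ne] := eqVneq j (i - 1).
    by rewrite (piece_comp_degl _ _ fD) // DD /piece comp_lfun0r comp_lfun0l.
  by rewrite (piece_off fD ne) comp_lfun0r.
- exact: pfiltered_piece fD.
Qed.

Lemma pfiltered_chain_map_piece D E
    (f : 'Hom(chains K (cells D), chains K (cells E))) :
  filtered_homog 0 f -> (f \o bdelta D = bdelta E \o f)%VF ->
  @pfiltered_chain_map K dP P (chain_data D) (chain_data E) (fun i => piece i i f).
Proof.
move=> ff cf; split=> [i j|i]; last exact: pfiltered_piece ff.
have -> : bd (chain_data D) i j = piece i j (bdelta D) by [].
have -> : bd (chain_data E) i j = piece i j (bdelta E) by [].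
by rewrite (piece_comp_degr _ _ ff) ?addr0 // cf (piece_comp_degl _ _ ff) ?addr0.
Qed.

Lemma pfiltered_homotopic_id_piece D (f h : 'End(chains K (cells D)))
    (F : forall i, 'End(Defs.space (chain_data D) i)) :
  filtered_homog (-1) (bdelta D) -> filtered_homog 1 h ->
  f - \1 = (bdelta D \o h) + (h \o bdelta D) ->
  (forall i, F i = piece i i f) ->
  @pfiltered_homotopic_id K dP P (chain_data D) F.
Proof.
move=> fD fh fE FE; exists (fun i j => piece i j h); split=> [i j|i j|i].
- exact: piece_neq0.
- exact: pfiltered_piece fh.
have -> : bd (chain_data D) (i + 1) i = piece (i + 1) i (bdelta D) by [].
have -> : bd (chain_data D) i (i - 1) = piece i (i - 1) (bdelta D) by [].
rewrite (piece_comp_degl _ _ fh) // (piece_comp_degl _ _ fD) // -pieceD -fE.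
by rewrite pieceD pieceN piece1 FE.
Qed.

Lemma pfiltered_equivalent_retract D E :
  based_complex D -> based_complex E -> filtered_retract D E ->
  pfiltered_equivalent (chain_data E) (chain_data D).
Proof.
move=> cD cE [f [g [h [[ff fg fh] cf cg gf fgE]]]].
split; [exact: pgraded_chain_data.. |].
exists (fun i => piece i i f), (fun i => piece i i g); split.
- exact: pfiltered_chain_map_piece.
- exact: pfiltered_chain_map_piece.
- apply: (@pfiltered_homotopic_id_piece E (\1%VF) 0).
  + exact: cE.2.
  + exact: filtered_homog0.
  + by rewrite comp_lfun0l comp_lfun0r subrr addr0.
  by move=> i; rewrite (piece_comp_degl _ _ ff) ?addr0 // gf.
- apply: (@pfiltered_homotopic_id_piece D (f \o g)%VF h) => //.
  + exact: cD.2.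
  by move=> i; rewrite (piece_comp_degl _ _ fg) ?addr0.
Qed.

Lemma strict_chain_data D :
  (forall x y : cells D, bgrade x = bgrade y -> @bkappa K P D x y = 0) ->
  strict (chain_data D).
Proof.
move=> zero i j p; apply/eqP/contraT => /block_neq0[x [y [nz gx gy]]].
by case/eqP: nz; apply: zero; rewrite gx gy.
Qed.

End Pieces.

(** * Partial matchings built by coreductions *)

Section Matchings.
Variables (K : fieldType) (T : finType) (k : T -> T -> K).

(** The partition is encoded by a count of memberships, which says at once
    that the three sets are disjoint and cover S.  Acyclicity is encoded by a
    rank function that decreases along the relation of the matching. *)
Record acyclic_matching (S : {set T}) (m : matching T) : Prop := {
  matching_partition :
    forall z, ((z \in mA m) + (z \in mK m) + (z \in mQ m))%N = (z \in S);
  matching_image : mK m = [set mw m x | x in mQ m];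
  matching_inj : {in mQ m &, injective (mw m)};
  matching_coef_neq0 : forall x, x \in mQ m -> k (mw m x) x != 0;
  matching_rank : exists r : T -> nat, forall x y, x \in mQ m -> y \in mQ m ->
    y != x -> k (mw m x) y != 0 -> (r y < r x)%N
}.

(** The last clause says that a cell still to be treated is not a face of any
    cell of K already removed; hence a newly matched cell of Q can be ranked
    above all the former ones. *)
Definition matching_invariant (S : {set T}) (s : mstate T) :=
  [/\ s.1 \subset S, acyclic_matching (S :\: s.1) s.2
    & forall x y, x \in mQ s.2 -> y \in s.1 -> k (mw s.2 x) y = 0].

Lemma matching_invariant_start S : matching_invariant S (matching_start S).
Proof.
split=> //= [|x y]; last by rewrite inE.
split=> /=.
- by move=> z; rewrite setDv !inE.
- by rewrite imset0.
- by move=> x y; rewrite inE.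
- by move=> x; rewrite inE.
- by exists (fun=> 0%N) => x y; rewrite inE.
Qed.

Hypothesis k_irr : forall x, k x x = 0.

(** A new cell of Q gets a rank above all the former ones.  It is the only
    remaining face of its partner, so that the last clause of the invariant
    persists. *)
Lemma matching_invariant_step S s s' :
  matching_step k s s' -> matching_invariant S s -> matching_invariant S s'.
Proof.
case=> [R m x y [xR yR kxy kx0]|R m x _ [xR kx0]] [/= RS [part im inj nz [r rP]] zero].
  have xy : x != y by apply: contraNneq kxy => ->; rewrite k_irr.
  have xS := subsetP RS _ xR; have yS := subsetP RS _ yR.
  have yQ : y \in mQ m = false.
    by move: (part y); rewrite !inE yR /=; case: (y \in mQ m); rewrite ?addn1.
  have wE z : z \in mQ m -> (if z == y then x else mw m z) = mw m z.
    by move=> zQ; case: eqP => // zy; rewrite -zy zQ in yQ.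
  have xK : x \in mK m = false.
    move: (part x); rewrite !inE xR /=.
    by case: (x \in mK m); rewrite ?addn1 ?addnS.
  have newx z : z \in mQ m -> mw m z != x.
    by move=> zQ; apply: contraFneq xK => <-; rewrite im imset_f.
  split=> /=; first by rewrite (subset_trans _ RS) // subsetDl.
    split=> /=.
    - move=> z; move: (part z); rewrite !inE.
      have [->|zx] := eqVneq z x.
        rewrite (negPf xy) xR xS xK /=.
        by case: (x \in mA m) (x \in mQ m) => [] [].
      have [->|zy] := eqVneq z y; last by rewrite /= ?orbF => ->.
      by rewrite yR yS yQ /=; case: (y \in mA m) (y \in mK m) => [] [].
    - rewrite im imsetU1 /= eqxx; congr (_ |: _).
      by apply: eq_in_imset => z zQ; exact/esym/wE.
    - move=> z t; rewrite !in_setU1 => /orP[/eqP->|zQ] /orP[/eqP->|tQ] //.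
      + by rewrite /= eqxx wE // => /esym/eqP; rewrite (negPf (newx _ tQ)).
      + by rewrite /= eqxx wE // => /eqP; rewrite (negPf (newx _ zQ)).
      + by rewrite /= !wE //; apply: inj.
    - move=> z; rewrite in_setU1 => /orP[/eqP->|zQ]; first by rewrite /= eqxx.
      by rewrite /= wE // nz.
    - exists (fun z => if z == y then (\max_(t in mQ m) r t).+1 else r z).
      move=> z t; rewrite !in_setU1.
      have [->|zy] /= := eqVneq z y.
        move=> _; have [->|ty] /= := eqVneq t y; first by [].
        by move=> tQ _ _; rewrite ltnS leq_bigmax_cond.
      move=> zQ; have [->|ty] /= := eqVneq t y.
        by move=> _ _; rewrite zero ?eqxx.
      exact: rP.
  move=> z t; rewrite !inE negb_or => /orP[/eqP->|zQ] /andP[/andP[tx ty] tR].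
    by rewrite /= eqxx kx0 // !inE ty.
  by rewrite /= wE // zero.
have xS := subsetP RS _ xR.
split=> /=; first by rewrite (subset_trans _ RS) // subsetDl.
  split=> //=; last by exists r.
  move=> z; move: (part z); rewrite !inE.
  have [->|zx] := eqVneq z x; last by move=> ->.
  by rewrite xR xS /=; case: (x \in mA m) (x \in mK m) (x \in mQ m) => [] [] [].
by move=> z t zQ; rewrite !inE => /andP[_ tR]; exact: zero.
Qed.

Lemma matching_outcome S s m :
  matching_leads_to k s m -> matching_invariant S s -> acyclic_matching S m.
Proof.
elim=> [m0 [_ /=]|{}s s' m0 step _ IH /(matching_invariant_step step)//].
by rewrite setD0.
Qed.

Lemma matching_leads_to_acyclic S m :
  matching_leads_to k (matching_start S) m -> acyclic_matching S m.
Proof. move=> run; exact: matching_outcome run (matching_invariant_start S). Qed.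

Lemma matching_step_mQ_sub s s' : matching_step k s s' -> mQ s.2 \subset mQ s'.2.
Proof. by case=> * //=; exact: subsetUr. Qed.

Lemma matching_leads_to_mQ_sub s m : matching_leads_to k s m -> mQ s.2 \subset mQ m.
Proof.
elim=> [//|{}s s' m0 /matching_step_mQ_sub sub _]; exact: subset_trans sub.
Qed.

(** Without pairs every step removes a free cell x from a set R that has no
    coreduction pair.  By induction on the rest of the run, the coefficients
    vanish on R minus x, so a cell z with nonzero coefficient at x would have x
    as its only face in R, that is, (z, x) would be a coreduction pair. *)
Lemma unmatched_coef0 s m : matching_leads_to k s m -> mQ m = set0 ->
  {in s.1 &, forall x y, k x y = 0}.
Proof.
elim=> [m0 _ x y|{}s s' m0 step run IH Q0]; first by rewrite inE.
have {}IH := IH Q0; move/matching_leads_to_mQ_sub: run; rewrite Q0 subset0.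
case: step IH => [R m1 x y _ _|R m1 x none [xR kx0] IH _ z t /= zR tR].
  by move=> /= /eqP/setP/(_ y); rewrite !inE eqxx.
have [->|zx] := eqVneq z x; first exact: kx0.
have [->|tx] := eqVneq t x; last by apply: IH; rewrite !inE ?zx ?tx.
apply/eqP/contraT => kzx; case: (none z x); split=> // u uR.
by apply: IH; rewrite // !inE ?zx.
Qed.

(** If there is no coreduction pair, a cell of least dimension is free, since
    its faces have smaller dimension. *)
Lemma matching_progress (dim : T -> nat) (s : mstate T) :
  (forall x y, k x y != 0 -> dim x = (dim y).+1) ->
  s.1 = set0 \/ exists s', matching_step k s s'.
Proof.
case: s => R m kdim; have [->|[x0 x0R]] := set_0Vmem R; [by left | right].
have [pair|none] := boolP [exists x in R, [exists y in R,
    (k x y != 0) && [forall z in R :\ y, k x z == 0]]].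
  case/existsP: pair => x /andP[xR /existsP[y /andP[yR /andP[kxy /forallP kx0]]]].
  eexists; apply: (@MatchPair _ _ _ _ _ x y); split=> // z zR.
  by apply/eqP; exact: (implyP (kx0 z)).
case: (arg_minnP dim x0R) => x xR xmin.
eexists; apply: (@MatchFree _ _ _ _ _ x).
  move=> y z [yR zR kyz ky0]; case/existsP: none; exists y; rewrite yR /=.
  apply/existsP; exists z; rewrite zR kyz /=; apply/forallP => t; apply/implyP.
  by move=> /ky0 ->.
split=> // y yR; apply/eqP/contraT => /kdim dxy.
by move: (xmin y yR); rewrite dxy ltnn.
Qed.

Lemma matching_always_halts (dim : T -> nat) (s : mstate T) :
  (forall x y, k x y != 0 -> dim x = (dim y).+1) -> matching_halts k s.
Proof.
move=> kdim; have [n] := ubnP #|s.1|; elim: n s => [|n IH] s le_sn.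
  by rewrite ltn0 in le_sn.
split; first exact: matching_progress kdim.
move=> s' step; apply: IH; rewrite ltnS in le_sn; apply: leq_trans le_sn.
apply: proper_card.
case: step => [R m x y [xR yR _ _]|R m x _ [xR _]] /=.
  by apply/properP; split; [exact: subsetDl | exists x; rewrite // !inE eqxx].
by apply/properP; split; [exact: subsetDl | exists x; rewrite // !inE eqxx].
Qed.

End Matchings.

(** * The union of the matchings of the fibres *)

Section UnionMatching.
Variables (K : fieldType) (dP : Order.disp_t) (P : finPOrderType dP).
Variables (D : based_data K P) (m : P -> matching (cells D)).
Hypothesis mP : forall p, acyclic_matching (@bkappa K P D) (fiber D p) (m p).

Let u := union_matching (@bgrade K P D) m.

Let fiber_of p z : [|| z \in mA (m p), z \in mK (m p) | z \in mQ (m p)] ->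
  bgrade z = p.
Proof.
have := matching_partition (mP p) z; rewrite inE.
by case: eqP => // _; do 3!case: (_ \in _).
Qed.

Lemma union_mA z : (z \in mA u) = (z \in mA (m (bgrade z))).
Proof.
apply/bigcupP/idP => [[p _ zp]|]; last by exists (bgrade z).
by rewrite (@fiber_of p z) // zp.
Qed.

Lemma union_mK z : (z \in mK u) = (z \in mK (m (bgrade z))).
Proof.
apply/bigcupP/idP => [[p _ zp]|]; last by exists (bgrade z).
by rewrite (@fiber_of p z) // zp orbT.
Qed.

Lemma union_mQ z : (z \in mQ u) = (z \in mQ (m (bgrade z))).
Proof.
apply/bigcupP/idP => [[p _ zp]|]; last by exists (bgrade z).
by rewrite (@fiber_of p z) // zp !orbT.
Qed.

Lemma union_mw z : z \in mQ u -> mw u z \in mK (m (bgrade z)).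
Proof. by rewrite union_mQ => zQ; rewrite (matching_image (mP _)); exact: imset_f. Qed.

Lemma union_mw_grade z : z \in mQ u -> bgrade (mw u z) = bgrade z.
Proof. by move=> /union_mw zK; apply: fiber_of; rewrite zK orbT. Qed.

Hypothesis filt : forall x y : cells D, @bkappa K P D x y != 0 ->
  (bgrade y <= bgrade x)%O.

(** The rank is lexicographic: first the height of the grade in P, counted by
    the number of smaller elements, then the rank within the fibre. *)
Lemma acyclic_union_matching : acyclic_matching (@bkappa K P D) setT u.
Proof.
split.
- move=> z; rewrite union_mA union_mK union_mQ (matching_partition (mP _)).
  by rewrite !inE eqxx.
- apply/setP => z; rewrite union_mK; apply/idP/imsetP => [|[x xQ ->]].
    rewrite (matching_image (mP _)) => /imsetP[x xQ zE].
    have gx : bgrade x = bgrade z by apply: fiber_of; rewrite xQ !orbT.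
    by exists x; rewrite ?union_mQ /= gx.
  by rewrite union_mw_grade // union_mw.
- move=> x y xQ yQ wxy; have gxy : bgrade x = bgrade y.
    by rewrite -(union_mw_grade xQ) -(union_mw_grade yQ) wxy.
  move: wxy xQ yQ; rewrite !union_mQ /= gxy => wxy xQ yQ.
  exact: (matching_inj (mP _)) wxy.
- by move=> x; rewrite union_mQ => /(matching_coef_neq0 (mP _)).
have [r rP] := fin_all_exists (fun p => matching_rank (mP p)).
(* [B] exceeds all ranks within fibres, so the grade dominates. *)
pose B := (\max_p \max_x r p x).+1; pose h (p : P) := #|[set q | (q < p)%O]|.
exists (fun x => h (bgrade x) * B + r (bgrade x) x)%N => x y xQ yQ yx kxy.
have := filt kxy; rewrite union_mw_grade // le_eqVlt => /orP[/eqP gyx|gyx].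
  move: xQ yQ; rewrite !union_mQ gyx ltn_add2l => xQ yQ.
  exact: rP.
have hyx : (h (bgrade y) < h (bgrade x))%N.
  apply/proper_card/properP; split; last by exists (bgrade y); rewrite !inE ?ltxx.
  by apply/subsetP => q; rewrite !inE => /lt_trans; apply.
have rB : (r (bgrade y) y < B)%N.
  rewrite ltnS; apply: leq_trans (leq_bigmax y) _.
  exact: (leq_bigmax (F := fun p => \max_x r p x)).
apply: leq_trans (leq_addr _ _); apply: leq_trans (_ : (h (bgrade y)).+1 * B <= _)%N.
  by rewrite mulSn addnC ltn_add2r.
by rewrite leq_mul2r hyx orbT.
Qed.

End UnionMatching.

(** * The operator gamma of an acyclic matching *)

Section GammaOfMatching.
Variables (K : fieldType) (T : finType) (D : 'End(chains K T)) (m : matching T).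
Hypothesis mP : acyclic_matching (coef D) setT m.
Let V := matching_V (coef D) m.
Let A : pred T := mem (mA m).

Lemma matching_cases z :
  [\/ [/\ z \in mA m, z \notin mK m & z \notin mQ m],
      [/\ z \notin mA m, z \in mK m & z \notin mQ m]
    | [/\ z \notin mA m, z \notin mK m & z \in mQ m]].
Proof.
move: (matching_partition mP z); rewrite inE.
by case: (z \in mA m) (z \in mK m) (z \in mQ m) => [] [] [] // _;
  [apply: Or31 | apply: Or32 | apply: Or33].
Qed.

Lemma matching_V_basis x : V (basis_chain K x) =
  if x \in mQ m then (coef D (mw m x) x)^-1 *: basis_chain K (mw m x) else 0.
Proof. exact: linear_ext_basis. Qed.

Lemma mw_in x : x \in mQ m -> mw m x \in mK m.
Proof. by move=> xQ; rewrite (matching_image mP) imset_f. Qed.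

Lemma notQ_of_K x : x \in mK m -> x \notin mQ m.
Proof. by move=> xK; case: (matching_cases x) => -[]; rewrite xK. Qed.

Lemma notA_of_K x : x \in mK m -> x \notin mA m.
Proof. by move=> xK; case: (matching_cases x) => -[]; rewrite xK. Qed.

Lemma notQ_of_A x : x \in mA m -> x \notin mQ m.
Proof. by move=> xA; case: (matching_cases x) => -[]; rewrite xA. Qed.

Lemma matching_VV : (V \o V)%VF = 0.
Proof.
apply: lfun_basisP => x; rewrite comp_lfunE matching_V_basis lfunE.
case: ifP => [xQ|_]; last exact: linear0.
by rewrite linearZ /= matching_V_basis (negPf (notQ_of_K (mw_in xQ))) /= scaler0.
Qed.

Lemma restr_matching_V : (restr K A \o V)%VF = 0.
Proof.
apply: lfun_basisP => x; rewrite comp_lfunE matching_V_basis lfunE.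
case: ifP => [xQ|_]; last exact: linear0.
apply/ffunP => -[y yA]; rewrite restrE !ffunE /=.
case: eqP => [yx|_]; last exact: scaler0.
by case/negP: (notA_of_K (mw_in xQ)); rewrite -yx.
Qed.

Lemma matching_V_incl : (V \o incl K A)%VF = 0.
Proof.
apply: lfun_basisP => -[x xA]; rewrite comp_lfunE incl_basis matching_V_basis lfunE.
by rewrite (negPf (notQ_of_A xA)).
Qed.

(** V is injective on chains supported in Q, as w is injective. *)
Lemma matching_V_eq0 (c : chains K T) x : V c = 0 -> x \in mQ m -> c x = 0.
Proof.
move=> /ffunP/(_ (mw m x)) + xQ.
rewrite lfun_expand sum_ffunE (bigD1 x) //= big1 => [|y yx].
  rewrite matching_V_basis xQ !ffunE eqxx addr0 => /eqP.
  rewrite scaler_eq0 scaler_eq0 oner_eq0 orbF invr_eq0.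
  by rewrite (negPf (matching_coef_neq0 mP xQ)) orbF => /eqP.
rewrite matching_V_basis ffunE; case: ifP => yQ; last by rewrite ffunE scaler0.
rewrite !ffunE; case: eqP => [wxy|_]; last by rewrite !scaler0.
by case/eqP: yx; apply/esym/(matching_inj mP).
Qed.

(** Up to nonzero scalars, V hits each basis chain of a cell of K. *)
Lemma comp_V0_K (W : vectType K) (M : 'Hom(chains K T, W)) x :
  (M \o V)%VF = 0 -> x \in mK m -> M (basis_chain K x) = 0.
Proof.
move=> MV; rewrite (matching_image mP) => /imsetP[y yQ ->].
have nz := matching_coef_neq0 mP yQ.
have /lfunP/(_ (basis_chain K y)) := MV.
rewrite comp_lfunE matching_V_basis yQ linearZ /= lfunE => /eqP.
by rewrite scaler_eq0 invr_eq0 (negPf nz) => /eqP.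
Qed.

(** A chain in the image of N has no component on Q, and its components on K
    are killed by M; hence only its components on A matter. *)
Lemma comp_through_A (W1 W2 : vectType K) (M : 'Hom(chains K T, W2))
    (N : 'Hom(W1, chains K T)) :
  (M \o V)%VF = 0 -> (V \o N)%VF = 0 ->
  (M \o (incl K A \o restr K A) \o N = M \o N)%VF.
Proof.
move=> MV VN; apply/lfunP => d; rewrite !comp_lfunE; set c := N d.
have Vc : V c = 0 by rewrite -comp_lfunE VN lfunE.
rewrite (lfun_expand M) [RHS](lfun_expand M); apply: eq_bigr => x _.
rewrite incl_restrE; case: ifPn => // xA; rewrite scale0r; apply/esym.
case: (matching_cases x) => -[xA' xK xQ]; first by rewrite /A /= xA' in xA.
  by rewrite (comp_V0_K MV xK) scaler0.
by rewrite (matching_V_eq0 Vc xQ) scale0r.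
Qed.

(** The scalar in the definition of V is chosen so that the coefficient at x
    itself cancels; what is left are the cells below x in the acyclic order. *)
Lemma gamma_ratio_Q x y : x \in mQ m ->
  gamma_ratio D V (basis_chain K x) y =
  if y == x then 0 else - (coef D (mw m x) x)^-1 * coef D (mw m x) y.
Proof.
move=> xQ; rewrite add_lfunE opp_lfunE comp_lfunE id_lfunE matching_V_basis xQ.
rewrite linearZ /= !ffunE; case: eqP => [->|_]; last by rewrite sub0r mulNr.
by apply/eqP; rewrite subr_eq0 eq_sym; apply/eqP/mulVf/(matching_coef_neq0 mP).
Qed.

(** By [gamma_ratio_Q] each factor id - D V lowers the rank of the cells of Q
    that occur, while cells outside of Q are fixed and then killed by V.  So the
    i-th term vanishes on x once i exceeds the rank of x. *)
Lemma gamma_exists : exists g, is_gamma D V g.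
Proof.
have [r rP] := matching_rank mP.
have term0 x i : x \notin mQ m ->
    V (gamma_power D V i (basis_chain K x)) = 0.
  move=> xQ; have Vx : V (basis_chain K x) = 0 by rewrite matching_V_basis (negPf xQ).
  by rewrite gamma_power_fix.
have vanish n : forall x i, (r x < n)%N -> (n <= i)%N ->
    V (gamma_power D V i (basis_chain K x)) = 0.
  elim: n => // n IH x [//|i] rx ni.
  have [xQ|] := boolP (x \in mQ m); last exact: term0.
  rewrite gamma_powerSr comp_lfunE -(comp_lfunE V) (lfun_expand (V \o _)).
  rewrite big1 // => y _; rewrite comp_lfunE gamma_ratio_Q //.
  case: eqP => [_|/eqP yx]; first exact: scale0r.
  have [yQ|yQ] := boolP (y \in mQ m); last by rewrite term0 ?scaler0.
  have [->|kxy] := eqVneq (coef D (mw m x) y) 0; first by rewrite mulr0 scale0r.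
  rewrite IH ?scaler0 //.
  by apply: leq_trans (rP _ _ xQ yQ yx kxy) _; rewrite -ltnS.
pose N := (\max_x r x).+1.
exists (\sum_(i < N) (V \o gamma_power D V i)%VF), N; split=> // i Ni.
apply: lfun_basisP => x; rewrite comp_lfunE lfunE; apply: vanish Ni.
by rewrite ltnS leq_bigmax.
Qed.

End GammaOfMatching.

(** * One pass through the loop, and the whole algorithm *)

Section Body.
Variables (K : fieldType) (dP : Order.disp_t) (P : finPOrderType dP).
Implicit Types D E : based_data K P.

Lemma based_complex_dim D : based_complex D ->
  forall x y, @bkappa K P D x y != 0 -> bdim x = (bdim y).+1.
Proof. by move=> [_ fD] x y /fD[]; lia. Qed.

Lemma based_complex_grade D : based_complex D ->
  forall x y, @bkappa K P D x y != 0 -> (bgrade y <= bgrade x)%O.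
Proof. by move=> [_ fD] x y /fD[]. Qed.

Lemma fibers_acyclic D (m : P -> matching (cells D)) : based_complex D ->
  (forall p, matching_leads_to (@bkappa K P D) (matching_start (fiber D p)) (m p)) ->
  forall p, acyclic_matching (@bkappa K P D) (fiber D p) (m p).
Proof.
move=> cD run p; apply: matching_leads_to_acyclic (run p) => x.
by apply/eqP/contraT => /(based_complex_dim cD)/n_Sn.
Qed.

Lemma filtered_homog_gamma D V g :
  filtered_homog (-1) (bdelta D) -> @filtered_homog K dP P D D 1 V ->
  is_gamma (bdelta D) V g -> filtered_homog 1 g.
Proof.
move=> fD fV [N [_ ->]].
have fB : @filtered_homog K dP P D D 0 (gamma_ratio (bdelta D) V).
  apply/filtered_homog_add/filtered_homog_opp; first exact: filtered_homog_id.
  exact: filtered_homog_comp fV fD _.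
have fpow i : @filtered_homog K dP P D D 0 (gamma_power (bdelta D) V i).
  elim: i => [|i IH]; first exact: filtered_homog_id.
  by rewrite gamma_powerSr; apply: filtered_homog_comp fB IH _.
elim: N => [|N IH]; first by rewrite big_ord0; exact: filtered_homog0.
rewrite big_ord_recr /=; apply: filtered_homog_add => //.
exact: (filtered_homog_comp (fpow N) fV).
Qed.

Lemma filtered_homog_incl D A g :
  @filtered_homog K dP P (@reduced_data K P D A g) D 0 (incl K (mem A)).
Proof.
move=> x y; rewrite incl_basis ffunE.
by case: (y =P val x) => [-> _|_]; [rewrite addr0 | rewrite eqxx].
Qed.

Lemma filtered_homog_restr D A g :
  @filtered_homog K dP P D (@reduced_data K P D A g) 0 (restr K (mem A)).
Proof.
move=> x y; rewrite restrE ffunE.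
by case: (val y =P x) => [<- _|_]; [rewrite addr0 | rewrite eqxx].
Qed.

Lemma filtered_homog_matching_V D (m : matching (cells D)) : based_complex D ->
  acyclic_matching (@bkappa K P D) setT m ->
  {in mQ m, forall x, bgrade (mw m x) = bgrade x} ->
  @filtered_homog K dP P D D 1 (matching_V (@bkappa K P D) m).
Proof.
move=> cD mP wg x y; rewrite linear_ext_basis.
case: ifP => [xQ|_]; last by rewrite ffunE eqxx.
rewrite !ffunE; case: (y =P mw m x) => [-> _|_]; last by rewrite scaler0 eqxx.
rewrite wg //; split=> //.
by have := based_complex_dim cD (matching_coef_neq0 mP xQ); lia.
Qed.

(** The hypothesis [mid] of the retract is supplied by [comp_through_A], with
    M = id - gamma D and N = id - D gamma. *)
Lemma cm_body_retract D E : based_complex D -> cm_body D E ->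
  based_complex E /\ filtered_retract D E.
Proof.
move=> cD [m g run u gP]; have mP := fibers_acyclic cD run.
have uP : acyclic_matching (@bkappa K P D) setT u.
  exact: acyclic_union_matching mP (based_complex_grade cD).
have fV := filtered_homog_matching_V cD uP (union_mw_grade mP).
have [DD fD] := cD; have fg := filtered_homog_gamma fD fV gP.
set V := matching_V _ u in gP fV; pose A : pred (cells D) := mem (mA u).
have VV : (V \o V)%VF = 0 := matching_VV uP.
have rV : (restr K A \o V)%VF = 0 := restr_matching_V uP.
have Vi : (V \o incl K A)%VF = 0 := matching_V_incl uP.
have ri := restr_incl K A.
have mid : ((\1 - (g \o bdelta D)) \o (incl K A \o restr K A) \o (\1 - (bdelta D \o g))
             = (\1 - (g \o bdelta D)) \o (\1 - (bdelta D \o g)))%VF.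
  apply: (comp_through_A uP).
    by rewrite comp_lfunDl comp_lfunNl comp_lfun1l (comp_gammaDV gP) subrr.
  by rewrite comp_lfunDr comp_lfunNr comp_lfun1r comp_lfunA (comp_VDgamma gP) subrr.
set E0 := reduced_data _ _.
have fM : @filtered_homog K dP P D D 0 (\1 - (g \o bdelta D))%VF.
  apply/filtered_homog_add/filtered_homog_opp; first exact: filtered_homog_id.
  exact: filtered_homog_comp fD fg _.
have fN : @filtered_homog K dP P D D 0 (\1 - (bdelta D \o g))%VF.
  apply/filtered_homog_add/filtered_homog_opp; first exact: filtered_homog_id.
  exact: filtered_homog_comp fg fD _.
have fphi : @filtered_homog K dP P E0 D 0 ((\1 - (g \o bdelta D)) \o incl K A)%VF.
  exact: filtered_homog_comp (@filtered_homog_incl D (mA u) g) fM (erefl _).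
have fpsi : @filtered_homog K dP P D E0 0 (restr K A \o (\1 - (bdelta D \o g)))%VF.
  exact: filtered_homog_comp fN (@filtered_homog_restr D (mA u) g) (erefl _).
split.
  split; first exact: (retract_DD gP DD VV ri Vi rV mid).
  exact: filtered_homog_comp fphi (filtered_homog_comp fD fpsi (erefl _)) (erefl _).
exists ((\1 - (g \o bdelta D)) \o incl K A)%VF.
exists (restr K A \o (\1 - (bdelta D \o g)))%VF, (- g); split.
- by split=> //; exact: filtered_homog_opp.
- exact: (retract_phi_chain gP DD VV ri Vi rV mid).
- exact: (retract_psi_chain gP DD VV ri Vi rV mid).
- exact: (retract_psi_phi gP VV ri Vi rV).
- exact: (retract_phi_psi DD mid).
Qed.

(** If no cell was dropped, then Q is empty and V = gamma = 0: the boundary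
    operator is the old one, and [unmatched_coef0] applies to each fibre. *)
Lemma cm_body_stable_strict D E : based_complex D -> cm_body D E ->
  ~ (#|cells E| < #|cells D|)%N -> strict (chain_data E).
Proof.
move=> cD [m g run u gP] /negP; have mP := fibers_acyclic cD run.
have uP : acyclic_matching (@bkappa K P D) setT u.
  exact: acyclic_union_matching mP (based_complex_grade cD).
rewrite /= card_sig -leqNgt => card_A.
have AT : mA u = setT.
  by apply/eqP; rewrite eqEcard subsetT cardsT.
have Q0 x : x \in mQ u = false.
  by case: (matching_cases uP x) => -[]; rewrite ?AT ?inE // => _ _ /negPf.
have V0 : matching_V (@bkappa K P D) u = 0.
  by apply: lfun_basisP => x; rewrite linear_ext_basis Q0 lfunE.
have g0 : g = 0 by have [S ->] := gamma_factor gP; rewrite V0 comp_lfun0l.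
apply: strict_chain_data => x y gxy; rewrite /bkappa /coef /= /reduced_boundary.
rewrite g0 !(comp_lfun0l, comp_lfun0r) subr0 comp_lfun1r comp_lfun1l.
rewrite !comp_lfunE restrE incl_basis.
apply: (unmatched_coef0 (run (bgrade (val x)))); rewrite ?inE //=.
  apply/setP => z; rewrite inE; apply/negbTE/negP => zQ.
  have /negP := negbT (Q0 z); apply; apply/bigcupP; by exists (bgrade (val x)).
exact/eqP/esym/gxy.
Qed.

Lemma cm_halts_based_complex D : based_complex D -> cm_halts D.
Proof.
have [n] := ubnP #|cells D|; elim: n D => [|n IH] D le_n cD.
  by rewrite ltn0 in le_n.
split.
- move=> p; exact: matching_always_halts (based_complex_dim cD).
- move=> m run; apply: gamma_exists.
  exact: acyclic_union_matching (fibers_acyclic cD run) (based_complex_grade cD).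
- move=> E body lt_ED; apply: IH; last exact: (cm_body_retract cD body).1.
  by rewrite ltnS in le_n; apply: leq_trans le_n.
Qed.

Lemma cm_returns_retract D E : cm_returns D E -> based_complex D ->
  [/\ based_complex E, strict (chain_data E) & filtered_retract D E].
Proof.
elim=> {D E} [D E body stable cD|D D' E body _ _ IH cD].
  have [cE ret] := cm_body_retract cD body.
  by split=> //; exact: cm_body_stable_strict body stable.
have [cD' ret] := cm_body_retract cD body; have [cE sE ret'] := IH cD'.
by split=> //; exact: filtered_retract_trans ret ret'.
Qed.

End Body.

Lemma cell_data_based_complex (K : fieldType) (dP : Order.disp_t)
    (P : finPOrderType dP) (dX : Order.disp_t) (X : finPOrderType dX)
    (cx : cell_complex K X) (nu : X -> P) :
  (forall x y : X, (x <= y)%O -> (nu x <= nu y)%O) ->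
  based_complex (cell_data cx nu).
Proof.
move=> nu_homo.
have kappaE x y : cell_boundary cx (basis_chain K x) y = kappa cx x y.
  rewrite linear_ext_basis sum_ffunE (bigD1 y) //= big1 ?addr0 => [|z /negPf zy].
    by rewrite !ffunE eqxx [LHS]mulr1.
  by rewrite !ffunE eq_sym zy scaler0.
split.
  apply: lfun_basisP => x; apply/ffunP => z.
  rewrite comp_lfunE lfun_expand sum_ffunE lfunE ffunE -[RHS](kappa_sq cx x z).
  by apply: eq_bigr => y _; rewrite ffunE !kappaE.
move=> x y; rewrite kappaE => /kappa_face[yx dxy]; split; last exact: nu_homo.
by rewrite /= dxy -addn1 PoszD addrK.
Qed.

Theorem theorem6p9 (K : fieldType) (dP : Order.disp_t) (P : finPOrderType dP)
    (dX : Order.disp_t) (X : finPOrderType dX) (cx : cell_complex K X)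
    (nu : X -> P) (nu_homo : forall x y : X, (x <= y)%O -> (nu x <= nu y)%O) :
  cm_halts (cell_data cx nu) /\
  forall D : based_data K P, cm_returns (cell_data cx nu) D ->
    conley_complex (chain_data D) (chain_data (cell_data cx nu)).
Proof.
have cX := cell_data_based_complex cx nu_homo.
split=> [|D /cm_returns_retract/(_ cX)[cD sD ret]].
  exact: cm_halts_based_complex.
split=> //; first exact: pgraded_chain_data.
exact: pfiltered_equivalent_retract.
Qed.
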